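(* For every $z_h\in\mathcal Z_h$, $\mathcal R_h^{\rm c}z_h\in H(\operatorname{div}_{\Gamma_h};\Gamma_h)$ and $\operatorname{div}_{\Gamma_h}\mathcal R_h^{\rm c}z_h=0$. Moreover, for every facewise tangential $f_h\in L^2(\Gamma_h)^3$, $$\ell_h^Z(f_h+\nabla_h\vartheta;z_h)=\ell_h^Z(f_h;z_h)\qquad\forall\vartheta\in H^1(\Gamma_h).$$
   Context: Surface and mesh. $\gamma\subset\mathbb R^3$ is a connected, closed, orientable surface of class $C^4$; $d$ is its signed distance on a thin tubular neighbourhood $U_\delta=\{x:\operatorname{dist}(x,\gamma)<\delta\}$; on $U_\delta$, $\nu=\nabla d$ and $\mathbf p(x)=x-d(x)\nu(x)$ (closest-point projection). $\Gamma_h\subset U_\delta$ is a connected, closed, coherently oriented polyhedral surface with a conforming partition $\mathcal T_h$ into planar polygons (faces), edge set $\mathcal E_h$ and vertex set $\mathcal V_h$. $h_K=\operatorname{diam}K$, $h=\max_K h_K$, and $0<h\le h_0\le 1$ with $h_0$ fixed sufficiently small. $\nu_K$ is the unit normal of $K$. Mesh assumption: there is $\rho>0$ independent of $h$ such that (M1) $\mathbf p:\Gamma_h\to\gamma$ is bijective and $\|d\|_{L^\infty(K)}\le Ch_K^2$, $\|\nu-\nu_K\|_{L^\infty(K)}\le Ch_K$, $\|1-\mu_h\|_{L^\infty(K)}\le Ch_K^2$ for all $K$, with $C$ independent of $h$ and $K$, where $\mu_h$ is the surface Jacobian, $d\sigma(\mathbf p(x))=\mu_h(x)\,d\sigma_h(x)$;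 (M2) every $K$ is star-shaped with respect to a disk of radius at least $\rho h_K$ (one such disk, with centre $x_K^c$, is fixed for each $K$); (M3) distinct vertices $a,b$ of $K$ satisfy $|a-b|\ge\rho h_K$. Face and edge notation. $\nabla_K,\operatorname{div}_K,\Delta_K$ are the planar gradient, divergence and Laplacian on $K$. Fields tangential to $K$ are identified with $\mathbb R^2$-valued fields. $\nabla_h,\operatorname{div}_h$ act facewise. For each edge $e$ fix an ordered pair $(K,L)$ of faces with $e=\partial K\cap\partial L$ and a unit tangent $t$ used on both sides; $n_K$ is the outward unit conormal of $\partial K$ in the plane of $K$. $[\![v\cdot n]\!]=v|_K\cdot n_K+v|_L\cdot n_L$. $\operatorname{div}_{\Gamma_h}$ is the distributional surface divergence on $\Gamma_h$ (dual, up to sign, to the gradient of functions in $H^1(\Gamma_h)$), and $H(\operatorname{div}_{\Gamma_h};\Gamma_h)$ is the space of facewise tangential $L^2$ fields $v$ with $\operatorname{div}_{\Gamma_h}v\in L^2(\Gamma_h)$; a piecewise $H^1$ tangential field belongs to it iff $[\![v\cdot n]\!]=0$ on every edge. Spaces. $\mathbb P_m(D)$: polynomials of degree $\le m$. $B_2(\partial K)=\{w\in C^0(\partial K):w|_e\in\mathbb P_2(e)\ \forall e\subset\partial K\}$. $\Sigma(K)=\{v\in[H^1(K)]^2: v|_{\partial K}\in[B_2(\partial K)]^2,\ \operatorname{div}_Kv\in\mathbb P_0(K),\ -\Delta_Kv-\nabla_Ks=0\text{ for some }s\in L^2(K)/\mathbb R\}$, $\mathcal Z(K)=\{v\in\Sigma(K):\operatorname{div}_Kv=0\}$.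 For each vertex $a$ one reference face $K_a\ni a$ is fixed; for faces $K\ni a$, $M_{a,K}x=(\nu_{K_a}\cdot\nu_K)x-\nu_{K_a}(\nu_K\cdot x)$ ($h_0$ is so small that $\nu_{K_a}\cdot\nu_K$ is uniformly positive). For a piecewise field $v_h$ with $v_K=v_h|_K$, $T_e(v_h)=\frac12\sum_{a\in\partial e}v_{K_a}(a)\cdot t$. $\Sigma_h$ is the set of $v_h$ with $v_K\in\Sigma(K)$ for all $K$ such that: $v_K(a)=M_{a,K}v_{K_a}(a)$ for all $a\in\mathcal V_h$ and $K\ni a$; $\int_e[\![v_h\cdot n]\!]\,ds=0$ for all $e\in\mathcal E_h$; $\frac1{|e|}\int_e v_K\cdot t\,ds=T_e(v_h)$ for all $K$ and $e\subset\partial K$. $\mathcal Z_h=\{v_h\in\Sigma_h:\operatorname{div}_hv_h=0\}$. Reconstruction and load. $\Pi_1^{\nabla,K}:[H^1(K)]^2\to[\mathbb P_1(K)]^2$ is defined by $(\nabla_K\Pi_1^{\nabla,K}v,\nabla_Kq)_K=(\nabla_Kv,\nabla_Kq)_K$ for all $q\in[\mathbb P_1(K)]^2$ and $\int_K\Pi_1^{\nabla,K}v=\int_Kv$. $\widehat{\mathcal T}_K$ is the fan triangulation of $K$ obtained by joining $x_K^c$ to the vertices of $K$. For $v\in\mathcal Z(K)$, $W_K(v)=\{r\in H(\operatorname{div};K):r|_T\in[\mathbb P_2(T)]^2\ \forall T\in\widehat{\mathcal T}_K,\ \operatorname{div}r=0,\ r\cdot n_K=v\cdot n_K\text{ on }\partial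 K\}$, and $\mathcal R_Kv$ is the unique minimizer over $r\in W_K(v)$ of $\|r-\Pi_1^{\nabla,K}v\|_{L^2(K)}^2$. For $z_h\in\mathcal Z_h$, $(\mathcal R_h^{\rm c}z_h)|_K=\mathcal R_K(z_h|_K)$, and $\ell_h^Z(f_h;z_h)=(f_h,\mathcal R_h^{\rm c}z_h)_{L^2(\Gamma_h)}$. *)

(* Defs.v *)
From HB Require Import structures.
From mathcomp Require Import all_boot all_order all_algebra.
From mathcomp Require Import all_classical all_reals all_analysis.
Set Implicit Arguments.
Unset Strict Implicit.
Unset Printing Implicit Defensive.
Import Order.TTheory GRing.Theory Num.Theory.
Import numFieldNormedType.Exports.
Local Open Scope classical_set_scope.
Local Open Scope ring_scope.

(** Conventions.
    - Scalar, vector and surface functions are represented by Borel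
      representatives; equality of L^2 classes is almost-everywhere equality.
    - MathComp-Analysis equips ['rV[R]_3] and [R * R] with the max norm; only
      the topology is taken from it.  Lengths, distances and diameters are
      Euclidean ([norm3], [norm2]).
    - A face is the image of a polygon of [R * R] under an isometric affine
      chart, and a tangential field on a face is given by its two components
      in that chart.  A function or field on the polyhedral surface is a family
      indexed by the faces (faces overlap only in null sets). *)

(** * Euclidean geometry *)

Definition dot3 (R : realType) (u v : 'rV[R]_3) : R := \sum_i u 0 i * v 0 i.
Definition norm3 (R : realType) (u : 'rV[R]_3) : R := Num.sqrt (dot3 u u).
(* indices are added modulo 3 *)
Definition cross3 (R : realType) (u v : 'rV[R]_3) : 'rV[R]_3 :=
  \row_(j < 3) (u 0 (j + 1) * v 0 (j + 2%:R) - u 0 (j + 2%:R) * v 0 (j + 1)).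
Definition dot2 (R : realType) (u v : R * R) : R := u.1 * v.1 + u.2 * v.2.
Definition norm2 (R : realType) (u : R * R) : R := Num.sqrt (dot2 u u).

Definition diam2 (R : realType) (D : set (R * R)) : R :=
  sup [set r | exists x y, [/\ D x, D y & r = norm2 (x - y)]].

Definition seg (R : realType) (V : lmodType R) (p q : V) (s : R) : V :=
  p + s *: (q - p).
Definition segment (R : realType) (V : lmodType R) (p q : V) : set V :=
  [set seg p q s | s in `[0, 1]].
Definition triangle (R : realType) (p q r : R * R) : set (R * R) :=
  [set x | exists a b c : R, [/\ 0 <= a, 0 <= b, 0 <= c, a + b + c = 1 &
     x = a *: p + b *: q + c *: r]].

(* consecutive pairs of a cyclic sequence *)
Definition cyc (T : Type) (s : seq T) : seq (T * T) := zip s (rot 1 s).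

(** [f] is of class C^n on the open set [U]. *)
Fixpoint Ck_on (R : realType) (V : normedModType R) (U : set V) (n : nat)
    (f : V -> R) : Prop :=
  (forall x, U x -> {for x, continuous f}) /\
  if n is m.+1 then
    forall v : V, (forall x, U x -> derivable f x v) /\
                  Ck_on U m (fun x => 'D_v f x)
  else True.

(** * The smooth surface *)

Definition grad3 (R : realType) (f : 'rV[R]_3 -> R) (x : 'rV[R]_3) : 'rV[R]_3 :=
  \row_i 'D_(delta_mx 0 i) f x.

(* An embedded surface is locally a regular level set.  Orientability needs no
   separate clause: compact surfaces embedded in 3-space are orientable. *)
Definition C4_closed_surface (R : realType) (gamma : set 'rV[R]_3) : Prop :=
  [/\ gamma !=set0, connected gamma, compact gamma &
    forall x, gamma x -> exists (U : set 'rV[R]_3) (f : 'rV[R]_3 -> R),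
      [/\ open U, U x, Ck_on U 4 f, grad3 f x != 0 &
          gamma `&` U = [set y | f y = 0] `&` U]].

Definition dist_set (R : realType) (gamma : set 'rV[R]_3) (x : 'rV[R]_3) : R :=
  inf [set norm3 (x - y) | y in gamma].
Definition tube (R : realType) (gamma : set 'rV[R]_3) (delta : R) :
    set 'rV[R]_3 := [set x | dist_set gamma x < delta].

(* [gamma] bounds the regular open set [Om], on which [d] is negative.  [Om] may
   be the bounded or the unbounded side, so both sign conventions are covered. *)
Definition signed_distance (R : realType) (gamma : set 'rV[R]_3) (delta : R)
    (d : 'rV[R]_3 -> R) : Prop :=
  exists Om : set 'rV[R]_3,
    [/\ open Om, Om = (closure Om)°, closure Om `\` Om = gamma &
      forall x, tube gamma delta x ->
        (Om x -> d x = - dist_set gamma x) /\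
        (~ Om x -> d x = dist_set gamma x)].

(* C^4 regularity of the signed distance is what the tube being thin means. *)
Definition tubular_nbhd (R : realType) (gamma : set 'rV[R]_3) (delta : R)
    (d : 'rV[R]_3 -> R) : Prop :=
  [/\ 0 < delta, signed_distance gamma delta d & Ck_on (tube gamma delta) 4 d].

Definition closest_point (R : realType) (d : 'rV[R]_3 -> R) (x : 'rV[R]_3) :
    'rV[R]_3 := x - d x *: grad3 d x.

(** * Polygons *)

(* [ctr] is the apex of the fan triangulation. *)
Record polygon (R : realType) := Polygon
  { reg : set (R * R); verts : seq (R * R); ctr : R * R }.
Definition edges (R : realType) (P : polygon R) := cyc (verts P).
Definition bnd (R : realType) (P : polygon R) : set (R * R) :=
  [set x | exists2 e, e \in edges P & segment e.1 e.2 x].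

(* The region enclosed by a simple closed polygonal curve, traversed
   counterclockwise (positive shoelace sum). *)
Definition simple_polygon (R : realType) (P : polygon R) : Prop :=
  [/\ uniq (verts P), (2 < size (verts P))%N,
      forall e e', e \in edges P -> e' \in edges P -> e != e' ->
        forall x, segment e.1 e.2 x -> segment e'.1 e'.2 x ->
          (x = e.1 \/ x = e.2) /\ (x = e'.1 \/ x = e'.2),
      [/\ compact (reg P), closure (reg P)° = reg P &
          reg P `\` (reg P)° = bnd P] &
      0 < \sum_(e <- edges P) (e.1.1 * e.2.2 - e.2.1 * e.1.2)].

(* outward unit conormal on the edge from [p] to [q] of a counterclockwise
   polygon *)
Definition conormal (R : realType) (p q : R * R) : R * R :=
  (norm2 (q - p))^-1 *: ((q - p).2, - (q - p).1).

Definition eint (R : realType) (p q : R * R) (g : R * R -> R) : R :=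
  norm2 (q - p) * \int[lebesgue_measure]_(s in `[0, 1]) g (seg p q s).

Definition star_shaped_disk (R : realType) (D : set (R * R)) (c : R * R) (r : R) :
    Prop :=
  forall y, norm2 (y - c) <= r -> forall x, D x -> segment y x `<=` D.

(** * Function spaces on a polygon *)

Definition leb2 (R : realType) : {measure set (measurableTypeR R *
    measurableTypeR R) -> \bar R} := (lebesgue_measure \x lebesgue_measure)%E.

Definition L2 (R : realType) (D : set (R * R)) (f : R * R -> R) : Prop :=
  measurable_fun (D : set (measurableTypeR R * measurableTypeR R)) f /\
  (\int[leb2 R]_(x in D) (f x ^+ 2)%:E < +oo)%E.
Definition L2v (R : realType) (D : set (R * R)) (v : R * R -> R * R) : Prop :=
  L2 D (fun x => (v x).1) /\ L2 D (fun x => (v x).2).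

Definition ip (R : realType) (D : set (R * R)) (f g : R * R -> R) : R :=
  \int[leb2 R]_(x in D) (f x * g x).
Definition ipv (R : realType) (D : set (R * R)) (v w : R * R -> R * R) : R :=
  \int[leb2 R]_(x in D) dot2 (v x) (w x).

Definition smooth (R : realType) (phi : R * R -> R) : Prop :=
  forall n, Ck_on setT n phi.
Definition cgrad (R : realType) (phi : R * R -> R) (x : R * R) : R * R :=
  ('D_((1, 0) : R * R) phi x, 'D_((0, 1) : R * R) phi x).
Definition testfun (R : realType) (D : set (R * R)) (phi : R * R -> R) : Prop :=
  smooth phi /\ exists S : set (R * R),
    [/\ compact S, S `<=` D° & forall x, ~ S x -> phi x = 0].

Definition is_wgrad (R : realType) (D : set (R * R)) (v : R * R -> R)
    (g : R * R -> R * R) : Prop :=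
  L2v D g /\ forall phi, testfun D phi ->
    ip D v (fun x => (cgrad phi x).1) = - ip D (fun x => (g x).1) phi /\
    ip D v (fun x => (cgrad phi x).2) = - ip D (fun x => (g x).2) phi.
Definition H1 (R : realType) (D : set (R * R)) (v : R * R -> R) : Prop :=
  L2 D v /\ exists g, is_wgrad D v g.
(* weak gradient of an H^1 function (meaningless outside H^1) *)
Definition wgrad (R : realType) (D : set (R * R)) (v : R * R -> R) :
    R * R -> R * R := xget (fun=> 0) [set g | is_wgrad D v g].

Definition H1v (R : realType) (D : set (R * R)) (v : R * R -> R * R) : Prop :=
  H1 D (fun x => (v x).1) /\ H1 D (fun x => (v x).2).
Definition wgradv (R : realType) (D : set (R * R)) (v : R * R -> R * R)
    (x : R * R) : (R * R) * (R * R) :=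
  (wgrad D (fun y => (v y).1) x, wgrad D (fun y => (v y).2) x).
Definition divv (R : realType) (D : set (R * R)) (v : R * R -> R * R)
    (x : R * R) : R := (wgradv D v x).1.1 + (wgradv D v x).2.2.
Definition ddot (R : realType) (A B : (R * R) * (R * R)) : R :=
  dot2 A.1 B.1 + dot2 A.2 B.2.

(* Trace operator H^1(P) -> L^2(bnd P), as the continuous extension of the
   restriction to the boundary of functions smooth up to the boundary. *)
Definition is_trace (R : realType) (P : polygon R) (v g : R * R -> R) : Prop :=
  (forall e, e \in edges P ->
     measurable_fun (`[0, 1] : set (measurableTypeR R))
       (fun s => g (seg e.1 e.2 s)) /\
     (\int[lebesgue_measure]_(s in `[0%R, 1%R])
        (g (seg e.1 e.2 s) ^+ 2)%:E < +oo)%E) /\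
  exists phi : nat -> R * R -> R,
    [/\ forall k, smooth (phi k),
      (\int[leb2 R]_(x in reg P) ((phi k x - v x) ^+ 2)%:E)%E
        @[k --> \oo] --> 0%E,
      (\int[leb2 R]_(x in reg P)
         (norm2 (cgrad (phi k) x - wgrad (reg P) v x) ^+ 2)%:E)%E
        @[k --> \oo] --> 0%E &
      forall e, e \in edges P ->
        (\int[lebesgue_measure]_(s in `[0%R, 1%R])
           ((phi k (seg e.1 e.2 s) - g (seg e.1 e.2 s)) ^+ 2)%:E)%E
          @[k --> \oo] --> 0%E].

Definition is_wdiv (R : realType) (D : set (R * R)) (r : R * R -> R * R)
    (w : R * R -> R) : Prop :=
  L2 D w /\ forall phi, testfun D phi -> ipv D r (cgrad phi) = - ip D w phi.
Definition Hdiv (R : realType) (D : set (R * R)) (r : R * R -> R * R) : Prop :=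
  L2v D r /\ exists w, is_wdiv D r w.

(* Normal trace of a field of H(div), defined by Green's formula.  [g p q x] is
   the value at the point [x] of the edge from [p] to [q]. *)
Definition is_normal_trace (R : realType) (P : polygon R)
    (r : R * R -> R * R) (g : R * R -> R * R -> R * R -> R) : Prop :=
  forall w, is_wdiv (reg P) r w -> forall phi, smooth phi ->
    ipv (reg P) r (cgrad phi) + ip (reg P) w phi =
    \sum_(e <- edges P) eint e.1 e.2 (fun x => g e.1 e.2 x * phi x).

(* polynomials of total degree at most m in two variables *)
Definition poly_deg (R : realType) (m : nat) (f : R * R -> R) : Prop :=
  exists c : nat -> nat -> R, forall x, f x =
    \sum_(i < m.+1) \sum_(j < m.+1 | (i + j <= m)%N) c i j * x.1 ^+ i * x.2 ^+ j.
Definition poly_degv (R : realType) (m : nat) (v : R * R -> R * R) : Prop :=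
  poly_deg m (fun x => (v x).1) /\ poly_deg m (fun x => (v x).2).

Definition B2 (R : realType) (P : polygon R) (w : R * R -> R) : Prop :=
  {within bnd P, continuous w} /\
  forall e, e \in edges P -> exists2 p : {poly R}, (size p <= 3)%N &
    forall s, s \in `[0, 1] -> w (seg e.1 e.2 s) = p.[s].

Definition is_B2_trace (R : realType) (P : polygon R)
    (v g : R * R -> R * R) : Prop :=
  [/\ is_trace P (fun x => (v x).1) (fun x => (g x).1),
      is_trace P (fun x => (v x).2) (fun x => (g x).2),
      B2 P (fun x => (g x).1) & B2 P (fun x => (g x).2)].

(* the continuous representative of the boundary trace of a field of [Sigma] *)
Definition bval (R : realType) (P : polygon R) (v : R * R -> R * R) :
    R * R -> R * R := xget (fun=> 0) [set g | is_B2_trace P v g].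

(* The last clause is - Laplacian v - grad s = 0 in the sense of distributions. *)
Definition Sigma (R : realType) (P : polygon R) (v : R * R -> R * R) : Prop :=
  [/\ H1v (reg P) v, exists g, is_B2_trace P v g,
      exists c, {ae leb2 R, forall x, reg P x -> divv (reg P) v x = c} &
      exists2 s, L2 (reg P) s & forall phi : R * R -> R * R,
        testfun (reg P) (fun x => (phi x).1) ->
        testfun (reg P) (fun x => (phi x).2) ->
        \int[leb2 R]_(x in reg P)
          (ddot (wgradv (reg P) v x)
             (cgrad (fun y => (phi y).1) x, cgrad (fun y => (phi y).2) x) +
           s x * ((cgrad (fun y => (phi y).1) x).1 +
                  (cgrad (fun y => (phi y).2) x).2)) = 0].

Definition Zspace (R : realType) (P : polygon R) (v : R * R -> R * R) : Prop :=
  Sigma P v /\ {ae leb2 R, forall x, reg P x -> divv (reg P) v x = 0}.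

(** * Local reconstruction *)

Definition is_Pi1 (R : realType) (D : set (R * R)) (v w : R * R -> R * R) :
    Prop :=
  [/\ poly_degv 1 w,
      forall q, poly_degv 1 q ->
        \int[leb2 R]_(x in D) ddot (wgradv D w x) (wgradv D q x) =
        \int[leb2 R]_(x in D) ddot (wgradv D v x) (wgradv D q x),
      \int[leb2 R]_(x in D) (w x).1 = \int[leb2 R]_(x in D) (v x).1 &
      \int[leb2 R]_(x in D) (w x).2 = \int[leb2 R]_(x in D) (v x).2].
Definition Pi1 (R : realType) (D : set (R * R)) (v : R * R -> R * R) :
    R * R -> R * R := xget (fun=> 0) [set w | is_Pi1 D v w].

(* On each triangle of the fan the field is polynomial almost everywhere:
   requiring it pointwise on closed triangles would force continuity across
   the interior edges. *)
Definition Wspace (R : realType) (P : polygon R) (v r : R * R -> R * R) : Prop :=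
  [/\ Hdiv (reg P) r,
      forall e, e \in edges P -> exists2 q, poly_degv 2 q &
        {ae leb2 R, forall x, triangle (ctr P) e.1 e.2 x -> r x = q x},
      is_wdiv (reg P) r (fun=> 0) &
      is_normal_trace P r (fun p q x => dot2 (bval P v x) (conormal p q))].

Definition is_recon (R : realType) (P : polygon R) (v r : R * R -> R * R) : Prop :=
  Wspace P v r /\ forall r', Wspace P v r' ->
    \int[leb2 R]_(x in reg P) (norm2 (r x - Pi1 (reg P) v x) ^+ 2) <=
    \int[leb2 R]_(x in reg P) (norm2 (r' x - Pi1 (reg P) v x) ^+ 2).

(** * Polyhedral surfaces *)

Definition chart_of (R : realType) (o t1 t2 : 'rV[R]_3) (y : R * R) : 'rV[R]_3 :=
  o + y.1 *: t1 + y.2 *: t2.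
Definition coord_of (R : realType) (o t1 t2 x : 'rV[R]_3) : R * R :=
  (dot3 (x - o) t1, dot3 (x - o) t2).

(* Vertices of a face are listed counterclockwise with respect to its normal
   [tau1 x tau2], so coherent orientation means that the two faces of an edge
   traverse it in opposite directions. *)
Record polysurf (R : realType) := PolySurf {
  vertex : finType;
  face : finType;
  pos : vertex -> 'rV[R]_3;
  fverts : face -> seq vertex;
  org : face -> 'rV[R]_3;
  tau1 : face -> 'rV[R]_3;
  tau2 : face -> 'rV[R]_3;
  freg : face -> set (R * R);
  (* the fixed disk with respect to which the face is star-shaped *)
  fctr : face -> R * R;
  frad : face -> R;
  (* reference face of a vertex *)
  fref : vertex -> face;
  (* unit tangent of an edge, used on both of its sides *)
  etan : vertex -> vertex -> 'rV[R]_3;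

  nu (K : face) : 'rV[R]_3 := cross3 (tau1 K) (tau2 K);
  chart (K : face) := chart_of (org K) (tau1 K) (tau2 K);
  loc (K : face) (a : vertex) := coord_of (org K) (tau1 K) (tau2 K) (pos a);
  fpoly (K : face) : polygon R :=
    Polygon (freg K) [seq loc K a | a <- fverts K] (fctr K);
  fedges (K : face) := cyc (fverts K);
  Gamma : set 'rV[R]_3 := [set x | exists K, exists2 y, freg K y & x = chart K y];

  pos_inj : injective pos;
  vertex_face : forall a, exists K, a \in fverts K;
  chart_orthonormal : forall K, [/\ dot3 (tau1 K) (tau1 K) = 1,
    dot3 (tau2 K) (tau2 K) = 1 & dot3 (tau1 K) (tau2 K) = 0];
  face_planar : forall K a, a \in fverts K -> dot3 (pos a - org K) (nu K) = 0;
  face_polygon : forall K, simple_polygon (fpoly K);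
  (* closed and coherently oriented *)
  edge_unique : forall K L e, e \in fedges K -> e \in fedges L -> K = L;
  edge_opposite : forall K a b, (a, b) \in fedges K ->
    exists L, (b, a) \in fedges L;
  (* the faces around a vertex are connected through edges at that vertex *)
  vertex_link : forall a K L, a \in fverts K -> a \in fverts L ->
    connect [rel K' L' : face | [exists b,
      ((a, b) \in fedges K') && ((b, a) \in fedges L') ||
      ((b, a) \in fedges K') && ((a, b) \in fedges L')]] K L;
  (* distinct faces meet only along common vertices and common edges *)
  conforming : forall K L, K != L -> forall y z, freg K y -> freg L z ->
    chart K y = chart L z ->
    (exists a, [/\ a \in fverts K, a \in fverts L & chart K y = pos a]) \/
    (exists a b, [/\ (a, b) \in fedges K, (b, a) \in fedges L &
                     segment (pos a) (pos b) (chart K y)]);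
  Gamma_connected : connected Gamma;
  fref_mem : forall a, a \in fverts (fref a);
  etan_sym : forall a b, etan a b = etan b a;
  etan_unit : forall K a b, (a, b) \in fedges K ->
    etan a b = (norm3 (pos b - pos a))^-1 *: (pos b - pos a) \/
    etan a b = - ((norm3 (pos b - pos a))^-1 *: (pos b - pos a)) }.

Definition hface (R : realType) (G : polysurf R) (K : face G) : R :=
  diam2 (freg K).
Definition meshsize (R : realType) (G : polysurf R) : R :=
  \big[Num.max/0]_(K : face G) hface K.

(* Jacobian of the closest-point projection on a face: by the area formula, the
   density of the surface measure of [gamma] in the chart of the face. *)
Definition surf_jac (R : realType) (d : 'rV[R]_3 -> R) (G : polysurf R)
    (K : face G) (y : R * R) : R :=
  let F (x : R * R) : 'rV[R]_3 := closest_point d (chart K x) in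
  norm3 (cross3 ('D_((1, 0) : R * R) F y) ('D_((0, 1) : R * R) F y)).

Definition mesh_assumption (R : realType) (gamma : set 'rV[R]_3) (delta : R)
    (d : 'rV[R]_3 -> R) (rho C : R) (G : polysurf R) : Prop :=
  [/\ Gamma G `<=` tube gamma delta,
      set_bij (Gamma G) gamma (closest_point d),
      forall (K : face G) y, freg K y ->
        [/\ `|d (chart K y)| <= C * hface K ^+ 2,
            norm3 (grad3 d (chart K y) - nu K) <= C * hface K &
            `|1 - surf_jac d K y| <= C * hface K ^+ 2],
      forall K : face G, rho * hface K <= frad K /\
        star_shaped_disk (freg K) (fctr K) (frad K) &
      forall (K : face G) a b, a \in fverts K -> b \in fverts K -> a != b ->
        rho * hface K <= norm3 (pos a - pos b)].

(* h_0 at most 1 and so small that the products of normals entering the vertex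
   maps are uniformly positive on all admissible meshes of size at most h_0. *)
Definition small_h0 (R : realType) (gamma : set 'rV[R]_3) (delta : R)
    (d : 'rV[R]_3 -> R) (rho C h0 : R) : Prop :=
  0 < h0 <= 1 /\ exists2 c : R, 0 < c &
    forall G : polysurf R, mesh_assumption gamma delta d rho C G ->
      0 < meshsize G <= h0 ->
      forall (a : vertex G) (K : face G), a \in fverts K ->
        c <= dot3 (nu (fref a)) (nu K).

(** * Spaces on the polyhedral surface *)

Definition surf_fun (R : realType) (G : polysurf R) := face G -> R * R -> R.
Definition surf_field (R : realType) (G : polysurf R) := face G -> R * R -> R * R.

Definition push (R : realType) (G : polysurf R) (K : face G) (u : R * R) :
    'rV[R]_3 := u.1 *: tau1 K + u.2 *: tau2 K.
(* point of parameter [s] on the edge from [a] to [b], in the chart of [K] *)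
Definition ept (R : realType) (G : polysurf R) (K : face G) (a b : vertex G)
    (s : R) : R * R := seg (loc K a) (loc K b) s.

Definition H1_surf (R : realType) (G : polysurf R) (theta : surf_fun G) : Prop :=
  (forall K, H1 (freg K) (theta K)) /\
  exists g : surf_fun G, (forall K, is_trace (fpoly K) (theta K) (g K)) /\
    forall K L a b, (a, b) \in fedges K -> (b, a) \in fedges L ->
      {ae (@lebesgue_measure R), forall s, s \in `[0, 1] ->
         g K (ept K a b s) = g L (ept L a b s)}.

Definition gradh (R : realType) (G : polysurf R) (theta : surf_fun G) : surf_field G :=
  fun K => wgrad (freg K) (theta K).

(* [w] is the distributional surface divergence of the tangential field [v] *)
Definition is_surf_div (R : realType) (G : polysurf R) (v : surf_field G)
    (w : surf_fun G) : Prop :=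
  (forall K, L2 (freg K) (w K)) /\
  forall theta, H1_surf theta ->
    \sum_K ipv (freg K) (v K) (gradh theta K) =
    - \sum_K ip (freg K) (w K) (theta K).
Definition Hdiv_surf (R : realType) (G : polysurf R) (v : surf_field G) : Prop :=
  (forall K, L2v (freg K) (v K)) /\ exists w, is_surf_div v w.

(* vertex value of [v_K], in 3-space *)
Definition vval (R : realType) (G : polysurf R) (v : surf_field G) (K : face G)
    (a : vertex G) : 'rV[R]_3 := push K (bval (fpoly K) (v K) (loc K a)).
Definition vmap (R : realType) (G : polysurf R) (a : vertex G) (K : face G)
    (x : 'rV[R]_3) : 'rV[R]_3 :=
  dot3 (nu (fref a)) (nu K) *: x - dot3 (nu K) x *: nu (fref a).

Definition Te (R : realType) (G : polysurf R) (v : surf_field G) (a b : vertex G) : R :=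
  2^-1 * (dot3 (vval v (fref a) a) (etan a b) +
          dot3 (vval v (fref b) b) (etan a b)).

Definition normal_jump (R : realType) (G : polysurf R) (v : surf_field G)
    (K L : face G) (a b : vertex G) (s : R) : R :=
  dot2 (bval (fpoly K) (v K) (ept K a b s)) (conormal (loc K a) (loc K b)) +
  dot2 (bval (fpoly L) (v L) (ept L a b s)) (conormal (loc L b) (loc L a)).

Definition Sigma_h (R : realType) (G : polysurf R) (v : surf_field G) : Prop :=
  [/\ forall K, Sigma (fpoly K) (v K),
      forall a (K : face G), a \in fverts K ->
        vval v K a = vmap a K (vval v (fref a) a),
      forall K L a b, (a, b) \in fedges K -> (b, a) \in fedges L ->
        norm3 (pos b - pos a) *
          \int[lebesgue_measure]_(s in `[0, 1]) normal_jump v K L a b s = 0 &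
      forall (K : face G) a b, (a, b) \in fedges K ->
        (norm3 (pos b - pos a))^-1 *
          eint (loc K a) (loc K b)
            (fun x => dot3 (push K (bval (fpoly K) (v K) x)) (etan a b)) =
        Te v a b].
Definition Z_h (R : realType) (G : polysurf R) (v : surf_field G) : Prop :=
  Sigma_h v /\
  forall K, {ae leb2 R, forall x, freg K x -> divv (freg K) (v K) x = 0}.

(** * Reconstruction and load *)

(* [r] is the conforming reconstruction of [z]; as an L^2 field it is unique, so
   a statement on it is one on every representative [r]. *)
Definition is_Rhc (R : realType) (G : polysurf R) (z r : surf_field G) : Prop :=
  forall K, is_recon (fpoly K) (z K) (r K).

Definition vfield3 (R : realType) (G : polysurf R) := face G -> R * R -> 'rV[R]_3.
Definition L2_tangential (R : realType) (G : polysurf R) (f : vfield3 G) : Prop :=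
  forall K, (forall i, L2 (freg K) (fun y => f K y 0 i)) /\
    {ae leb2 R, forall y, freg K y -> dot3 (f K y) (nu K) = 0}.
Definition push_field (R : realType) (G : polysurf R) (v : surf_field G) : vfield3 G :=
  fun K y => push K (v K y).

Definition ip_surf (R : realType) (G : polysurf R) (f g : vfield3 G) : R :=
  \sum_K \int[leb2 R]_(y in freg K) dot3 (f K y) (g K y).

(* the load functional at a field whose reconstruction is [r] *)
Definition loadZ (R : realType) (G : polysurf R) (f : vfield3 G) (r : surf_field G) :
    R := ip_surf f (push_field r).

(* Main.v *)
Require Import Defs.
From mathcomp Require Import all_boot all_order all_algebra.
From mathcomp Require Import all_classical all_reals all_analysis.
From mathcomp Require Import measurable_realfun ring lra.
Set Implicit Arguments.
Unset Strict Implicit.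
Unset Printing Implicit Defensive.
Import Order.TTheory GRing.Theory Num.Theory.
Import numFieldNormedType.Exports.
Local Open Scope classical_set_scope.
Local Open Scope ring_scope.

(** On each face the reconstruction is divergence-free with the normal trace of
    [z_h], so by density of smooth functions in H^1 (for the graph norm together
    with traces) Green's formula turns its pairing with a surface H^1 gradient
    into edge integrals of [z_K . n_K] against the trace of [theta].  The normal
    jump of [z_h] vanishes on every edge: it is a quadratic polynomial along the
    edge, it vanishes at both endpoints because the conormal component of
    [M_{a,K} v] is the same, up to sign, for the two faces of the edge, and its
    mean is zero.  The two sides of each edge therefore cancel. *)

(** * Square-integrable functions and passage to the limit in their pairings *)

Section L2_pairing.
Context d (T : measurableType d) (R : realType).
Variables (mu : {measure set T -> \bar R}) (D : set T).
Hypothesis mD : measurable D.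
Implicit Types f g : T -> R.

(** The measure is arbitrary so that, by conversion, this covers both [L2] on a face and the square
    integrability of traces in the edge parameter demanded by [is_trace]. *)
Definition sqint f :=
  measurable_fun D f /\ (\int[mu]_(x in D) (f x ^+ 2)%:E < +oo)%E.

Lemma sqint_integrable_sqr f : sqint f ->
  mu.-integrable D (EFin \o (fun x => f x ^+ 2)).
Proof.
move=> [mf fi]; apply/integrableP; split.
  by apply/measurable_EFinP; exact: measurable_funX.
under eq_integral do rewrite /= ger0_norm ?sqr_ge0//.
by [].
Qed.

(** Domination by the pointwise bound $|fg|\le f^2+g^2$. *)
Lemma sqint_integrableM f g : sqint f -> sqint g ->
  mu.-integrable D (EFin \o (fun x => f x * g x)).
Proof.
move=> f2 g2; apply: le_integrable (integrableD mD (sqint_integrable_sqr f2)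
  (sqint_integrable_sqr g2)) => //.
- by apply/measurable_EFinP; apply: measurable_funM; [case: f2|case: g2].
- move=> x Dx /=; rewrite lee_fin [leRHS]ger0_norm ?addr_ge0 ?sqr_ge0// ler_norml.
  by apply/andP; split; nra.
Qed.

Lemma sqintD f g : sqint f -> sqint g -> sqint (fun x => f x + g x).
Proof.
move=> f2 g2; split; first by apply: measurable_funD; [case: f2|case: g2].
have i1 := integrableD mD (sqint_integrable_sqr f2) (sqint_integrable_sqr g2).
(* The dominating function is $2f^2+2g^2$, which exceeds $(f+g)^2$ by $(f-g)^2$. *)
have i2 := integrableD mD i1 i1.
have /integrableP[_] : mu.-integrable D (EFin \o (fun x => (f x + g x) ^+ 2)).
  apply: le_integrable i2 => //.
    apply/measurable_EFinP; apply: measurable_funX.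
    by apply: measurable_funD; [case: f2|case: g2].
  move=> x Dx /=; rewrite lee_fin [leLHS]ger0_norm ?sqr_ge0// ler_normr.
  apply/orP; left.
  rewrite -subr_ge0 (_ : _ - _ = (f x - g x) ^+ 2) ?sqr_ge0//=; ring.
by under eq_integral do rewrite /= ger0_norm ?sqr_ge0//.
Qed.

Lemma sqintMr f k : sqint f -> sqint (fun x => f x * k).
Proof.
move=> f2; split; first by apply: measurable_funM => //; case: f2.
have /integrableP[_] := integrableZl mD (k ^+ 2) (sqint_integrable_sqr f2).
congr (_ < _)%E; apply: eq_integral => x _ /=.
by rewrite exprMn mulrC ger0_norm// mulr_ge0 ?sqr_ge0.
Qed.

(** A weighted Young inequality, in the role of Cauchy-Schwarz: the free weight [c] makes one term
    small, and the other factor then has to absorb $c^{-1}$. *)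
Lemma sqint_le_Rintegral f g c : sqint f -> sqint g -> 0 < c ->
  `|\int[mu]_(x in D) (f x * g x)| <=
  c * \int[mu]_(x in D) (f x ^+ 2) + c^-1 * \int[mu]_(x in D) (g x ^+ 2).
Proof.
move=> f2 g2 c0.
have if2 := sqint_integrable_sqr f2; have ig2 := sqint_integrable_sqr g2.
have ifg := sqint_integrableM f2 g2.
have ic : mu.-integrable D (EFin \o (fun x => c * f x ^+ 2)).
  by have := integrableZl mD c if2.
have id' : mu.-integrable D (EFin \o (fun x => c^-1 * g x ^+ 2)).
  by have := integrableZl mD c^-1 ig2.
apply: le_trans (le_normr_Rintegral mD ifg) _.
rewrite -!RintegralZl// -RintegralD//; apply: le_Rintegral => //.
- by have := integrable_abse ifg.
- by have := integrableD mD ic id'.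
- move=> x Dx; rewrite normrM.
  rewrite -[X in c * X]real_normK ?num_real// -[X in c^-1 * X]real_normK ?num_real//.
  set a := `|f x|; set b := `|g x|.
  have -> : c * a ^+ 2 + c^-1 * b ^+ 2 =
    a * b + c^-1 * ((c * a - b / 2) ^+ 2 + 3 / 4 * b ^+ 2).
    by field; rewrite gt_eqF.
  rewrite lerDl mulr_ge0 ?invr_ge0 ?(ltW c0)// addr_ge0 ?sqr_ge0//.
  by rewrite mulr_ge0 ?sqr_ge0.
Qed.

(** The squared distances live in the extended reals, so their convergence to 0 makes them finite
    only from some index on. *)
Lemma near_sqint_sub g (g_ : nat -> T -> R) :
  sqint g -> (forall k, measurable_fun D (g_ k)) ->
  (\int[mu]_(x in D) ((g_ k x - g x) ^+ 2)%:E)%E @[k --> \oo] --> 0%E ->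
  \forall k \near \oo, sqint (fun x => g_ k x - g x).
Proof.
move=> g2 mg_ /fine_cvgP[fin _].
near=> k; split; first by apply: measurable_funB => //; case: g2.
by rewrite ltey_eq; apply/orP; left; near: k.
Unshelve. all: by end_near. Qed.

(** Strong $L^2$ convergence implies weak convergence: the weighted Young inequality bounds the
    pairing of [f] with [g_ k - g]. *)
Lemma cvg_Rintegral_sqint f g (g_ : nat -> T -> R) :
  sqint f -> sqint g -> (forall k, measurable_fun D (g_ k)) ->
  (\int[mu]_(x in D) ((g_ k x - g x) ^+ 2)%:E)%E @[k --> \oo] --> 0%E ->
  \int[mu]_(x in D) (f x * g_ k x) @[k --> \oo] -->
    \int[mu]_(x in D) (f x * g x).
Proof.
move=> f2 g2 mg_ cvg_.
have e2 := near_sqint_sub g2 mg_ cvg_; have /fine_cvgP[_ cv] := cvg_.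
apply/cvgrPdist_le => e e0.
set A := \int[mu]_(x in D) (f x ^+ 2).
have A0 : 0 <= A by apply: Rintegral_ge0 => x _; exact: sqr_ge0.
(* This weight makes the term in [f] at most [e / 2]; the added 1 keeps the denominator positive
   when [A] is 0. *)
pose c := e / (2 * (A + 1)).
have c0 : 0 < c by rewrite divr_gt0// mulr_gt0// ltr_wpDl.
have cA : c * A <= e / 2.
  have : c * (2 * (A + 1)) = e.
    by rewrite /c divfK// mulf_neq0// gt_eqF// ltr_wpDl.
  by move: c0; clear; lra.
near=> k.
have ek : sqint (fun x => g_ k x - g x) by near: k.
have -> : \int[mu]_(x in D) (f x * g_ k x) =
    \int[mu]_(x in D) (f x * g x) + \int[mu]_(x in D) (f x * (g_ k x - g x)).
  rewrite -RintegralD//; try exact: sqint_integrableM.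
  by apply: eq_Rintegral => x _; ring.
rewrite opprD addrA subrr sub0r normrN.
apply: le_trans (sqint_le_Rintegral f2 ek c0) _.
rewrite (splitr e) lerD//.
rewrite ler_pdivrMl//.
have -> : \int[mu]_(x in D) ((g_ k x - g x) ^+ 2) =
  fine (\int[mu]_(x in D) ((g_ k x - g x) ^+ 2)%:E)%E by [].
apply: le_trans (ler_norm _) _; near: k.
move/cvgr0Pnorm_le : cv; apply.
by rewrite mulr_gt0// divr_gt0.
Unshelve. all: by end_near. Qed.

End L2_pairing.

(** * Borel measurability in the plane *)

Section plane_measurability.
Context {R : realType}.
Let T2 := (measurableTypeR R * measurableTypeR R)%type.

(** The measurable structure is the product one, so an open set has to be exhibited as a countable
    union of boxes with rational corners. *)
Lemma open_measurable2 (U : set (R * R)) : open U -> measurable (U : set T2).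
Proof.
move=> oU.
pose box (q : (rat * rat) * (rat * rat)) : set (R * R) :=
  `]ratr q.1.1, ratr q.1.2[%classic `*` `]ratr q.2.1, ratr q.2.2[%classic.
have -> : U = \bigcup_(q in [set q | box q `<=` U]) box q.
  apply/seteqP; split => [x Ux|x [q qU] /qU//].
  have /nbhs_ballP[e /= e0 xeU] : nbhs x U by exact: open_nbhs_nbhs.
  have h y : exists p : rat * rat, [/\ y - e < ratr p.1, ratr p.1 < y,
      y < ratr p.2 & ratr p.2 < y + e].
    have [q1 /[!in_itv]/andP[? ?]] := @rat_in_itvoo R (y - e) y ltac:(lra).
    have [q2 /[!in_itv]/andP[? ?]] := @rat_in_itvoo R y (y + e) ltac:(lra).
    by exists (q1, q2); split.
  have [p [p1 p2 p3 p4]] := h x.1; have [q [q1 q2 q3 q4]] := h x.2.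
  exists (p, q) => /=; last by split; rewrite /= in_itv/= ?p2 ?q2.
  move=> z [] /=; rewrite !in_itv/= => /andP[? ?] /andP[? ?]; apply: xeU.
  by split; rewrite /ball/= ltr_norml; apply/andP; split; lra.
rewrite bigcup_mkcond; apply: countable_bigcupT_measurable => // q.
by case: ifPn => _; [apply: measurableX; exact: measurable_itv|exact: measurable0].
Qed.

Lemma compact_measurable2 (D : set (R * R)) : compact D -> measurable (D : set T2).
Proof.
move=> cD; rewrite -(setCK D); apply: measurableC; apply: open_measurable2.
by apply: closed_openC; apply: compact_closed => //; exact: norm_hausdorff.
Qed.

Lemma continuous_measurable_fun2 (D : set (R * R)) (f : R * R -> R) :
  continuous f -> measurable_fun (D : set T2) f.
Proof.
move=> /continuousP cf; apply: measurable_funTS => /=.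
apply: (measurability _ (RGenOpens.measurableE R)).
move=> _ [_ [a [b ->] <-]]; rewrite setTI; apply: open_measurable2.
exact/cf/interval_open.
Qed.

End plane_measurability.

(** * Invariance of Lebesgue measure under $x\mapsto 1-x$ *)

Section reflection.
Context {R : realType}.
Let mu := @lebesgue_measure R.

(** By uniqueness of Lebesgue measure it suffices to treat half-open intervals; the reflection
    closes the other end but keeps the length. *)
Lemma lebesgue_measure_onem (A : set R) : measurable A ->
  pushforward mu ((fun x => 1 - x) : R -> measurableTypeR R) A = mu A.
Proof.
move=> mA.
have mo : measurable_fun setT
    ((fun x => 1 - x) : measurableTypeR R -> measurableTypeR R).
  exact: measurable_funB.
apply/esym/lebesgue_measure_unique => //= _ [[a b]] _ <-.
rewrite /pushforward (_ : _ @^-1` _ = `[1 - b, 1 - a[%classic); last first.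
  apply/seteqP; split => x /=; rewrite !in_itv/= => /andP[? ?];
  apply/andP; split; lra.
rewrite !lebesgue_measure_itv/= !lte_fin.
rewrite (_ : (1 - b < 1 - a) = (a < b)); last by apply/idP/idP; lra.
by case: ifP => // _; rewrite -!EFinB; congr EFin; ring.
Qed.

(** Needed because the two faces of an edge parametrize it in opposite directions. *)
Lemma Rintegral_onem01 (f : R -> R) : mu.-integrable `[0, 1] (EFin \o f) ->
  \int[mu]_(x in `[0, 1]) f (1 - x) = \int[mu]_(x in `[0, 1]) f x.
Proof.
move=> fi; congr fine.
have mo : measurable_fun setT
    ((fun x => 1 - x) : measurableTypeR R -> measurableTypeR R).
  exact: measurable_funB.
have m01 : measurable (`[0, 1] : set (measurableTypeR R)) by exact: measurable_itv.
(* Extension by zero carries the change of variables to the whole line, where the reflection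
   preserves the measure. *)
pose F := (EFin \o f) \_ `[0, 1].
have iF : mu.-integrable setT F.
  by apply/integrable_restrict => //; rewrite setTI.
have [mF Foo] := integrableP _ _ _ iF.
have iF' : mu.-integrable setT (F \o (fun x => 1 - x)).
  apply/integrableP; split; first exact: (measurableT_comp mF mo).
  apply: le_lt_trans Foo.
  have mF' : measurable_fun setT (abse \o F) by exact: measurableT_comp.
  have := @ge0_integral_pushforward _ _ _ _ R _ mo mu setT (abse \o F)
    measurableT mF' (fun _ _ => abse_ge0 _).
  rewrite preimage_setT => <-.
  by rewrite (eq_measure_integral mu)// => A mA _; exact: lebesgue_measure_onem.
transitivity (\int[mu]_x F (1 - x)%R)%E.
  rewrite integral_mkcond; apply: eq_integral => x _ /=.
  rewrite /F !patchE (_ : (1 - x \in `[0, 1]%classic) = (x \in `[0, 1]%classic))//.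
  by apply/idP/idP; rewrite !inE/= !in_itv/= => /andP[? ?]; apply/andP; split; lra.
rewrite [RHS]integral_mkcond -/F.
rewrite -(@integral_pushforward _ _ _ _ R _ mo mu setT F)//.
by apply: eq_measure_integral => // A mA _; exact: lebesgue_measure_onem.
Qed.

End reflection.

(** * Green's formula against $H^1$ functions *)

Section green.
Context {R : realType}.
Implicit Types (D : set (R * R)) (phi : R * R -> R).
Let T2 := (measurableTypeR R * measurableTypeR R)%type.
Let mu := @lebesgue_measure R.

Lemma smooth_continuous phi : smooth phi -> continuous phi.
Proof. by move=> /(_ 0)[cphi _] x; exact: cphi. Qed.

Lemma smooth_continuous_derive phi v : smooth phi -> continuous ('D_v phi).
Proof. by move=> /(_ 1)[_ /(_ v)[_ [cphi _]]] x; exact: cphi. Qed.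

Lemma continuous_seg (p q : R * R) : continuous (seg p q).
Proof.
move=> s; apply: cvgD; first exact: cvg_cst.
by apply: cvgZr_tmp.
Qed.

Lemma dot2_norm2 (u : R * R) : norm2 u ^+ 2 = dot2 u u.
Proof. by rewrite sqr_sqrtr// addr_ge0// -expr2 sqr_ge0. Qed.

Lemma ipvE D (v w : R * R -> R * R) : measurable (D : set T2) ->
  L2v D v -> L2v D w ->
  ipv D v w = ip D (fun x => (v x).1) (fun x => (w x).1) +
              ip D (fun x => (v x).2) (fun x => (w x).2).
Proof.
by move=> mD [v1 v2] [w1 w2]; rewrite -RintegralD//; exact: sqint_integrableM.
Qed.

Lemma cvg_component_sqr D (h : nat -> T2 -> R * R) (c : nat -> T2 -> R) :
  measurable (D : set T2) ->
  (forall k, measurable_fun (D : set T2) (fun x => (h k x).1)) ->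
  (forall k, measurable_fun (D : set T2) (fun x => (h k x).2)) ->
  (forall k, measurable_fun (D : set T2) (c k)) ->
  (forall k x, c k x ^+ 2 <= norm2 (h k x) ^+ 2) ->
  (\int[leb2 R]_(x in D) (norm2 (h k x) ^+ 2)%:E)%E @[k --> \oo] --> 0%E ->
  (\int[leb2 R]_(x in D) (c k x ^+ 2)%:E)%E @[k --> \oo] --> 0%E.
Proof.
move=> mD mh1 mh2 mc ch; apply: squeeze_cvge; last exact: cvg_cst.
near=> k; apply/andP; split.
  by apply: integral_ge0 => x _; rewrite lee_fin sqr_ge0.
apply: ge0_le_integral => //.
- by move=> x _; rewrite lee_fin sqr_ge0.
- by apply/measurable_EFinP; exact: measurable_funX.
- apply/measurable_EFinP; under eq_fun do rewrite dot2_norm2.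
  by apply: measurable_funD; exact: measurable_funM.
- by move=> x _; rewrite lee_fin.
Unshelve. all: by end_near. Qed.

(** [is_normal_trace] gives Green's formula for smooth functions only. The sequence in [is_trace]
    approximates [theta] by smooth functions, with gradients converging on the polygon and
    restrictions converging on each edge, so both sides pass to the limit. *)
Lemma normal_trace_green (P : polygon R) (r : R * R -> R * R)
    (g : R * R -> R * R -> R * R -> R) (theta h : R * R -> R) :
  compact (reg P) -> is_wdiv (reg P) r (fun=> 0) -> L2v (reg P) r ->
  is_normal_trace P r g ->
  (forall e, e \in edges P -> sqint mu `[0, 1]
     (fun s => g e.1 e.2 (seg e.1 e.2 s))) ->
  H1 (reg P) theta -> is_trace P theta h ->
  ipv (reg P) r (wgrad (reg P) theta) =
  \sum_(e <- edges P) eint e.1 e.2 (fun x => g e.1 e.2 x * h x).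
Proof.
move=> cP divr r2 rg g2 [theta2 [w wtheta]] [h2 [phi [sphi _ cgrad_cvg tr_cvg]]].
have mP := compact_measurable2 cP.
(* [wgrad] is a choice with a default value; the existence of some weak gradient ensures that the
   chosen one is genuine. *)
have [grad2 _] : is_wgrad (reg P) theta (wgrad (reg P) theta).
  exact: (xgetI _ wtheta).
set u := wgrad (reg P) theta in grad2 cgrad_cvg *.
have mc1 k : measurable_fun (reg P : set T2) (fun x => (cgrad (phi k) x).1).
  by apply: continuous_measurable_fun2; exact: smooth_continuous_derive.
have mc2 k : measurable_fun (reg P : set T2) (fun x => (cgrad (phi k) x).2).
  by apply: continuous_measurable_fun2; exact: smooth_continuous_derive.
have md1 k : measurable_fun (reg P : set T2) (fun x => (cgrad (phi k) x).1 - (u x).1).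
  by apply: measurable_funB => //; case: grad2 => -[].
have md2 k : measurable_fun (reg P : set T2) (fun x => (cgrad (phi k) x).2 - (u x).2).
  by apply: measurable_funB => //; case: grad2 => _ [].
have cvg1 : (\int[leb2 R]_(x in reg P)
    (((cgrad (phi k) x).1 - (u x).1) ^+ 2)%:E)%E @[k --> \oo] --> 0%E.
  apply: (@cvg_component_sqr _ (fun k x => cgrad (phi k) x - u x)
    _ mP md1 md2) cgrad_cvg => // k x.
  by rewrite dot2_norm2 /dot2 -!expr2 lerDl sqr_ge0.
have cvg2 : (\int[leb2 R]_(x in reg P)
    (((cgrad (phi k) x).2 - (u x).2) ^+ 2)%:E)%E @[k --> \oo] --> 0%E.
  apply: (@cvg_component_sqr _ (fun k x => cgrad (phi k) x - u x)
    _ mP md1 md2) cgrad_cvg => // k x.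
  by rewrite dot2_norm2 /dot2 -!expr2 lerDr sqr_ge0.
have n1 := near_sqint_sub grad2.1 mc1 cvg1.
have n2 := near_sqint_sub grad2.2 mc2 cvg2.
have lhs : ipv (reg P) r (cgrad (phi k)) @[k --> \oo] --> ipv (reg P) r u.
  rewrite ipvE//.
  have := cvgD (cvg_Rintegral_sqint mP r2.1 grad2.1 mc1 cvg1)
    (cvg_Rintegral_sqint mP r2.2 grad2.2 mc2 cvg2).
  move=> /(_ _) hh; apply: (cvg_trans _ hh); apply: near_eq_cvg; near=> k.
  (* Splitting the pairing into components requires [cgrad (phi k)] in $L^2$. This holds for large
     [k], as the gradient is [u] plus an eventually square-integrable difference. *)
  rewrite /= [RHS]ipvE//; split.
    rewrite (_ : (fun x => _) = fun x => ((cgrad (phi k) x).1 - (u x).1) + (u x).1).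
      by apply: sqintD => //; [near: k|exact: grad2.1].
    by apply/funext => x; rewrite subrK.
  rewrite (_ : (fun x => _) = fun x => ((cgrad (phi k) x).2 - (u x).2) + (u x).2).
    by apply: sqintD => //; [near: k|exact: grad2.2].
  by apply/funext => x; rewrite subrK.
have rhs : \sum_(e <- edges P) eint e.1 e.2 (fun x => g e.1 e.2 x * phi k x)
    @[k --> \oo] -->
    \sum_(e <- edges P) eint e.1 e.2 (fun x => g e.1 e.2 x * h x).
  rewrite big_seq; under eq_fun do rewrite big_seq.
  apply: (@cvg_big _ _ +%R 0 _ add_continuous) => e eP.
  apply: cvgM; first exact: cvg_cst.
  apply: cvg_Rintegral_sqint => //; [exact: g2|exact: h2| |exact: tr_cvg].
  move=> k; apply: measurable_funTS; apply: continuous_measurable_fun.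
  move=> s; apply: continuous_comp; first exact: continuous_seg.
  exact: smooth_continuous.
have eqk k : ipv (reg P) r (cgrad (phi k)) =
    \sum_(e <- edges P) eint e.1 e.2 (fun x => g e.1 e.2 x * phi k x).
  (* The divergence is 0, so Green's formula has no volume term besides the gradient pairing. *)
  rewrite -(rg _ divr _ (sphi k)) /ip.
  under [X in _ + X]eq_Rintegral do rewrite mul0r.
  by rewrite Rintegral_cst// mul0r addr0.
move: lhs; under eq_fun do rewrite eqk.
move=> lhs; exact: (cvg_unique _ lhs rhs).
Unshelve. all: by end_near. Qed.

End green.

(** * Scalar and cross product identities in 3-space *)

Section vector_algebra.
Context {R : realType}.
Implicit Types u v w x m t : 'rV[R]_3.

Lemma dot3E u v :
  dot3 u v = u 0 0 * v 0 0 + u 0 1 * v 0 1 + u 0 2%:R * v 0 2%:R.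
Proof.
rewrite /dot3 !big_ord_recl big_ord0 addr0 !addrA.
by congr (_ + u 0 _ * v 0 _ + u 0 _ * v 0 _); apply: val_inj.
Qed.

Lemma dot3C u v : dot3 u v = dot3 v u.
Proof. by apply: eq_bigr => i _; rewrite mulrC. Qed.

Lemma dot3Dl u v w : dot3 (u + v) w = dot3 u w + dot3 v w.
Proof. by rewrite -big_split; apply: eq_bigr => i _; rewrite mxE mulrDl. Qed.

Lemma dot3Zl a u w : dot3 (a *: u) w = a * dot3 u w.
Proof. by rewrite mulr_sumr; apply: eq_bigr => i _; rewrite mxE mulrA. Qed.

Lemma dot3Dr u v w : dot3 w (u + v) = dot3 w u + dot3 w v.
Proof. by rewrite !(dot3C w) dot3Dl. Qed.

Lemma dot3Zr a u w : dot3 w (a *: u) = a * dot3 w u.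
Proof. by rewrite !(dot3C w) dot3Zl. Qed.

Lemma dot3Nl u w : dot3 (- u) w = - dot3 u w.
Proof. by rewrite -scaleN1r dot3Zl mulN1r. Qed.

Lemma dot3Nr u w : dot3 w (- u) = - dot3 w u.
Proof. by rewrite !(dot3C w) dot3Nl. Qed.

Lemma dot3_eq0 u : dot3 u u = 0 -> u = 0.
Proof.
move=> /eqP; rewrite psumr_eq0 => [/allP u0|i _]; last by rewrite -expr2 sqr_ge0.
apply/rowP => i; rewrite mxE; apply/eqP.
have /implyP := u0 i (mem_index_enum i).
by rewrite mulf_eq0 orbb; apply.
Qed.

Lemma cross3_0 u v : cross3 u v 0 0 = u 0 1 * v 0 2%:R - u 0 2%:R * v 0 1.
Proof. by rewrite mxE; congr (u 0 _ * v 0 _ - u 0 _ * v 0 _); apply: val_inj. Qed.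

Lemma cross3_1 u v : cross3 u v 0 1 = u 0 2%:R * v 0 0 - u 0 0 * v 0 2%:R.
Proof. by rewrite mxE; congr (u 0 _ * v 0 _ - u 0 _ * v 0 _); apply: val_inj. Qed.

Lemma cross3_2 u v : cross3 u v 0 2%:R = u 0 0 * v 0 1 - u 0 1 * v 0 0.
Proof. by rewrite mxE; congr (u 0 _ * v 0 _ - u 0 _ * v 0 _); apply: val_inj. Qed.

Definition cross3E := (cross3_0, cross3_1, cross3_2).

(** The Gram determinant of [x], [t1], [t2] equals the square of their triple product. For
    orthonormal [t1], [t2] this is Parseval's identity in the frame completed by [cross3 t1 t2]. *)
Lemma gram_det3 x t1 t2 :
  dot3 x x * (dot3 t1 t1 * dot3 t2 t2 - dot3 t1 t2 ^+ 2) =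
  dot3 x (cross3 t1 t2) ^+ 2 + dot3 t1 t1 * dot3 x t2 ^+ 2
  + dot3 t2 t2 * dot3 x t1 ^+ 2 - 2 * dot3 t1 t2 * dot3 x t1 * dot3 x t2.
Proof. by rewrite !dot3E !cross3E; ring. Qed.

(** With $n=t_1\times t_2$, the left side is $(m\times x)\cdot(n\times t_1)$ by the Binet-Cauchy
    identity, and $n\times t_1=(t_1\cdot t_1)t_2-(t_1\cdot t_2)t_1$. The next lemma is the same with
    $n\times t_2$. *)
Lemma cross3_tangent2 m x t1 t2 :
  dot3 m (cross3 t1 t2) * dot3 x t1 - dot3 m t1 * dot3 x (cross3 t1 t2) =
  dot3 (cross3 m x) t2 * dot3 t1 t1 - dot3 (cross3 m x) t1 * dot3 t1 t2.
Proof. by rewrite !dot3E !cross3E; ring. Qed.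

Lemma cross3_tangent1 m x t1 t2 :
  dot3 m (cross3 t1 t2) * dot3 x t2 - dot3 m t2 * dot3 x (cross3 t1 t2) =
  dot3 (cross3 m x) t2 * dot3 t1 t2 - dot3 (cross3 m x) t1 * dot3 t2 t2.
Proof. by rewrite !dot3E !cross3E; ring. Qed.

End vector_algebra.

(** * Consecutive pairs of a cyclic sequence *)

Section cyclic_pairs.

Lemma mem_cyc (T : eqType) (s : seq T) e :
  e \in cyc s -> (e.1 \in s) /\ (e.2 \in s).
Proof.
have sz : size s = size (rot 1 s) by rewrite size_rot.
move=> es; split.
  by rewrite -(@unzip1_zip _ _ s (rot 1 s)) ?sz//; exact: map_f.
by rewrite -(mem_rot 1) -(@unzip2_zip _ _ s (rot 1 s)) ?sz//; exact: map_f.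
Qed.

Lemma cyc_map (T U : Type) (f : T -> U) s :
  cyc (map f s) = [seq (f e.1, f e.2) | e <- cyc s].
Proof.
rewrite /cyc -map_rot; move: (rot 1 s) => t.
by elim: s t => [|x s IHs] [|y t] //=; rewrite IHs.
Qed.

Lemma cyc_uniq (T : eqType) (s : seq T) : uniq s -> uniq (cyc s).
Proof. by move=> us; apply: zip_uniql; rewrite ?size_rot. Qed.
End cyclic_pairs.

(** * Face charts, edge vectors and conormals *)

Section face_geometry.
Context {R : realType} (G : polysurf R).
Implicit Types (K L : face G) (a b c : vertex G) (u w : R * R) (x : 'rV[R]_3).

Lemma dot3_push K u w : dot3 (push K u) (push K w) = dot2 u w.
Proof.
have [t11 t22 t12] := chart_orthonormal K.
rewrite /push /dot2 !dot3Dl !dot3Dr !dot3Zl !dot3Zr t11 t22.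
by rewrite (dot3C (tau2 K)) t12; ring.
Qed.

Lemma dot3_push_tau1 K u : dot3 (push K u) (tau1 K) = u.1.
Proof.
have [t11 _ t12] := chart_orthonormal K.
by rewrite /push dot3Dl !dot3Zl (dot3C (tau2 K)) t11 t12; ring.
Qed.

Lemma dot3_push_tau2 K u : dot3 (push K u) (tau2 K) = u.2.
Proof.
have [_ t22 t12] := chart_orthonormal K.
by rewrite /push dot3Dl !dot3Zl t22 t12; ring.
Qed.

Lemma dot3_push_nu K u : dot3 (push K u) (nu K) = 0.
Proof. by rewrite /push /nu dot3Dl !dot3Zl !dot3E !cross3E; ring. Qed.

(** The difference of the two sides has zero component along [tau1], [tau2] and [nu], hence zero
    length by [gram_det3]. *)
Lemma push_tangent K x : dot3 x (nu K) = 0 ->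
  push K (dot3 x (tau1 K), dot3 x (tau2 K)) = x.
Proof.
move=> xn; have [t11 t22 t12] := chart_orthonormal K.
set u := (_, _); apply/eqP; rewrite -subr_eq0; apply/eqP; apply: dot3_eq0.
have := gram_det3 (push K u - x) (tau1 K) (tau2 K).
move: (dot3_push_nu K u) (dot3_push_tau1 K u) (dot3_push_tau2 K u).
rewrite -/(nu K) t11 t22 t12; move: (push K u) => p pn p1 p2.
rewrite !(dot3Dl p) !dot3Nl pn p1 p2 xn /= !subrr expr0n/=.
by rewrite !(mulr0, mulr1, subr0, addr0).
Qed.

(** Planarity of the face makes the edge vector tangential, so its chart coordinates determine
    it. *)
Lemma push_locB K a b : a \in fverts K -> b \in fverts K ->
  push K (loc K b - loc K a) = pos b - pos a.
Proof.
move=> aK bK; rewrite -[RHS](@push_tangent K).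
  congr push; rewrite /loc /coord_of; congr pair;
  by rewrite /= -dot3Nl -dot3Dl opprB addrA subrK.
rewrite (_ : _ - _ = (pos b - org K) - (pos a - org K)).
  by rewrite dot3Dl dot3Nl !face_planar// subr0.
by rewrite opprB addrA subrK.
Qed.

Lemma norm2_locB K a b : a \in fverts K -> b \in fverts K ->
  norm2 (loc K b - loc K a) = norm3 (pos b - pos a).
Proof. by move=> aK bK; rewrite /norm3 -(push_locB aK bK) dot3_push. Qed.

Lemma norm3B (x y : 'rV[R]_3) : norm3 (x - y) = norm3 (y - x).
Proof. by rewrite /norm3 -opprB dot3Nl dot3Nr opprK. Qed.

(* The conormal is [n_K = t x nu_K] with [t] the unit direction of the edge, so
   for [m] the reference normal the component of [M_{c,K} v] along it is
     (m . nu_K)(v . n_K) - (m . n_K)(v . nu_K) = (m x v) . (nu_K x n_K)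
                                               = (m x v) . t,
   which depends on the face only through the sign of [t]. *)
Lemma vmap_conormal K a b c u x : a \in fverts K -> b \in fverts K ->
  push K u = vmap c K x ->
  dot2 u (conormal (loc K a) (loc K b)) =
  (norm3 (pos b - pos a))^-1 *
  dot3 (cross3 (nu (fref c)) x) (pos b - pos a).
Proof.
move=> aK bK ux; have [t11 t22 t12] := chart_orthonormal K.
rewrite /conormal (norm2_locB aK bK) -(push_locB aK bK).
set q := loc K b - loc K a; set m := nu (fref c).
have E1 := cross3_tangent1 m x (tau1 K) (tau2 K).
have E2 := cross3_tangent2 m x (tau1 K) (tau2 K).
rewrite -/(nu K) t12 t22 in E1; rewrite -/(nu K) t11 t12 in E2.
have u1 : u.1 = dot3 (cross3 m x) (tau2 K).
  rewrite -(dot3_push_tau1 K) ux /vmap -/m dot3Dl dot3Nl !dot3Zl.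
  by rewrite (dot3C (nu K)); lra.
have u2 : u.2 = - dot3 (cross3 m x) (tau1 K).
  rewrite -(dot3_push_tau2 K) ux /vmap -/m dot3Dl dot3Nl !dot3Zl.
  by rewrite (dot3C (nu K)); lra.
rewrite /dot2 /= u1 u2 /push dot3Dr !dot3Zr.
by rewrite /GRing.scale/=; ring.
Qed.

Lemma edges_fpoly K :
  edges (fpoly K) = [seq (loc K e.1, loc K e.2) | e <- fedges K].
Proof. exact: cyc_map. Qed.

Lemma fedges_uniq K : uniq (fedges K).
Proof.
by apply: cyc_uniq; have [/map_uniq] := face_polygon K.
Qed.

End face_geometry.

(** * Quadratic functions on the unit interval *)

Section quadratic.
Context {R : realType}.
Let mu := @lebesgue_measure R.
Implicit Types f g : R -> R.

(** Only values on $[0,1]$ are constrained, since [B2] controls a boundary function on the edges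
    alone. *)
Definition quadratic01 f := exists a b c : R,
  forall s, s \in `[0, 1] -> f s = a + b * s + c * s ^+ 2.

Lemma quadratic01D f g : quadratic01 f -> quadratic01 g ->
  quadratic01 (fun s => f s + g s).
Proof.
move=> [a [b [c fE]]] [a' [b' [c' gE]]]; exists (a + a'), (b + b'), (c + c').
by move=> s s01; rewrite fE// gE//; ring.
Qed.

Lemma quadratic01M f k : quadratic01 f -> quadratic01 (fun s => f s * k).
Proof.
move=> [a [b [c fE]]]; exists (a * k), (b * k), (c * k).
by move=> s s01; rewrite fE//; ring.
Qed.

Lemma onem_in01 (s : R) : s \in `[0, 1] -> 1 - s \in `[0, 1].
Proof. by rewrite !in_itv/= => /andP[? ?]; apply/andP; split; lra. Qed.

Lemma quadratic01_onem f : quadratic01 f -> quadratic01 (fun s => f (1 - s)).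
Proof.
move=> [a [b [c fE]]]; exists (a + b + c), (- b - 2 * c), c.
by move=> s s01; rewrite fE ?onem_in01//; ring.
Qed.

Lemma continuous_quadratic (a b c : R) :
  continuous (fun s => a + b * s + c * s ^+ 2).
Proof.
move=> s; apply: cvgD; last by apply: cvgM; [exact: cvg_cst|exact: exprn_continuous].
by apply: cvgD; [exact: cvg_cst|apply: cvgM; [exact: cvg_cst|exact: cvg_id]].
Qed.

Lemma integrable01_continuous f : continuous f ->
  mu.-integrable `[0, 1] (EFin \o f).
Proof.
move=> cf; apply: continuous_compact_integrable; first exact: segment_compact.
exact: continuous_subspaceT.
Qed.

Lemma quadratic01_sqint f : quadratic01 f -> sqint mu `[0, 1] f.
Proof.
move=> [a [b [c fE]]]; pose q s := a + b * s + c * s ^+ 2.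
have cq : continuous q by exact: continuous_quadratic.
split.
  apply: (eq_measurable_fun q); first by move=> s; rewrite inE => /fE.
  by apply: measurable_funTS; exact: continuous_measurable_fun.
have /integrableP[_] : mu.-integrable `[0, 1] (EFin \o (fun s => q s * q s)).
  by apply: integrable01_continuous => s; apply: cvgM; exact: cq.
congr (_ < _)%E; apply: eq_integral => s; rewrite inE => /fE fs.
by rewrite /= ger0_norm -?expr2 ?sqr_ge0// fs.
Qed.

(** Vanishing at both ends leaves $c(s^2-s)$, whose mean is $-c/6$. *)
Lemma quadratic01_eq0 f : quadratic01 f -> f 0 = 0 -> f 1 = 0 ->
  \int[mu]_(s in `[0, 1]) f s = 0 -> forall s, s \in `[0, 1] -> f s = 0.
Proof.
move=> [a [b [c fE]]] f0 f1.
have a0 : a = 0 by move: f0; rewrite fE ?in_itv/= ?lexx ?ler01//; lra.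
have bc : b = - c.
  by move: f1; rewrite fE ?in_itv/= ?lexx ?ler01// a0; lra.
(* The polynomial $s^2-s$ is invariant under $s\mapsto 1-s$; powers of $1-s$ match the form of
   [Rintegral_onemXn]. *)
have fE' s : s \in `[0, 1] -> f s = c * ((1 - s) ^+ 2 - (1 - s) ^+ 1).
  by move=> s01; rewrite fE// a0 bc; ring.
have ci n : mu.-integrable `[0, 1] (EFin \o (fun s : R => (1 - s) ^+ n)).
  apply: integrable01_continuous => s.
  apply: (@continuous_comp _ _ _ (fun s : R => 1 - s) (fun s : R => s ^+ n)).
    by apply: cvgB; [exact: cvg_cst|exact: cvg_id].
  exact: exprn_continuous.
rewrite (@eq_Rintegral _ _ _ mu _
  (fun s => c * ((1 - s) ^+ 2 - (1 - s) ^+ 1))); last first.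
  by move=> s; rewrite inE => /fE'.
rewrite RintegralZl//; last by have := integrableB _ (ci 2%N) (ci 1%N); exact.
rewrite RintegralB// !Rintegral_onemXn => c0.
have {}c0 : c = 0 by lra.
by move=> s s01; rewrite fE'// c0 mul0r.
Qed.

End quadratic.

(** * Boundary traces of local fields along edges *)

Section boundary_values.
Context {R : realType}.
Implicit Types (P : polygon R) (v : R * R -> R * R).

Lemma bvalP P v : Sigma P v -> is_B2_trace P v (bval P v).
Proof. by case=> _ [g gP] _ _; exact: (xgetI _ gP). Qed.

Lemma B2_quadratic P (w : R * R -> R) e : B2 P w -> e \in edges P ->
  quadratic01 (fun s => w (seg e.1 e.2 s)).
Proof.
move=> [_ /[apply]] [p sp pE]; exists p`_0, p`_1, p`_2 => s s01.
by rewrite pE// (horner_coef_wide _ sp) !big_ord_recl big_ord0/=; ring.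
Qed.

Lemma bval_quadratic P v e n : Sigma P v -> e \in edges P ->
  quadratic01 (fun s => dot2 (bval P v (seg e.1 e.2 s)) n).
Proof.
move=> /bvalP[_ _ b1 b2] eP; rewrite /dot2.
exact: quadratic01D (quadratic01M n.1 (B2_quadratic b1 eP))
  (quadratic01M n.2 (B2_quadratic b2 eP)).
Qed.

Lemma seg_onem (p q : R * R) s : seg q p (1 - s) = seg p q s.
Proof. by rewrite /seg; congr pair; rewrite /= /GRing.scale/=; ring. Qed.

Lemma seg0 (p q : R * R) : seg p q 0 = p.
Proof. by rewrite /seg scale0r addr0. Qed.

Lemma seg1 (p q : R * R) : seg p q 1 = q.
Proof. by rewrite /seg scale1r subrKC. Qed.

End boundary_values.

(** * Cancellation of the fluxes across edges *)

Section edge_cancellation.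
Context {R : realType} (G : polysurf R).
Let mu := @lebesgue_measure R.
Implicit Types (K L : face G) (a b c : vertex G) (z r : surf_field G).

Lemma mem_edges_fpoly K a b : (a, b) \in fedges K ->
  (loc K a, loc K b) \in edges (fpoly K).
Proof.
by move=> abK; rewrite edges_fpoly; apply/mapP; exists (a, b).
Qed.

(** Both faces take their value at [c] from the same reference value and reference normal, so
    [vmap_conormal] yields one expression evaluated on opposite edge vectors. *)
Lemma vertex_normal_jump z K L a b c : Sigma_h z ->
  (a, b) \in fedges K -> (b, a) \in fedges L -> c \in fverts K -> c \in fverts L ->
  dot2 (bval (fpoly K) (z K) (loc K c)) (conormal (loc K a) (loc K b)) +
  dot2 (bval (fpoly L) (z L) (loc L c)) (conormal (loc L b) (loc L a)) = 0.
Proof.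
move=> [_ zv _ _] /mem_cyc[aK bK] /mem_cyc[bL aL] cK cL.
rewrite (vmap_conormal aK bK (zv _ _ cK)) (vmap_conormal bL aL (zv _ _ cL)).
by rewrite norm3B -(opprB (pos a)) dot3Nr mulrN addNr.
Qed.

Lemma normal_jump_eq0 z K L a b : Sigma_h z ->
  (a, b) \in fedges K -> (b, a) \in fedges L -> norm3 (pos b - pos a) != 0 ->
  forall s, s \in `[0, 1] -> normal_jump z K L a b s = 0.
Proof.
move=> zS abK baL ab0.
have [[aK bK] [bL aL]] := (mem_cyc abK, mem_cyc baL).
have [zK _ zj _] := zS.
apply: quadratic01_eq0.
- apply: quadratic01D.
    exact: (bval_quadratic _ (zK K) (mem_edges_fpoly abK)).
  have := quadratic01_onem (bval_quadratic (conormal (loc L b) (loc L a))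
    (zK L) (mem_edges_fpoly baL)).
  by under eq_fun do rewrite seg_onem.
- by rewrite /normal_jump /ept !seg0; exact: vertex_normal_jump zS abK baL aK aL.
- by rewrite /normal_jump /ept !seg1; exact: vertex_normal_jump zS abK baL bK bL.
- by have /eqP := zj _ _ _ _ abK baL; rewrite mulf_eq0 (negPf ab0) => /eqP.
Qed.

(** After reflecting the parameter on [L], the integrands are opposite almost everywhere: the normal
    jump of [z] is 0 and the two traces of [g] agree. *)
Lemma edge_flux_opposite z (g : surf_fun G) K L a b : Sigma_h z ->
  (a, b) \in fedges K -> (b, a) \in fedges L ->
  sqint mu `[0, 1] (fun s => g K (ept K a b s)) ->
  sqint mu `[0, 1] (fun s => g L (ept L b a s)) ->
  {ae mu, forall s, s \in `[0, 1] -> g K (ept K a b s) = g L (ept L a b s)} ->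
  eint (loc K a) (loc K b) (fun x =>
    dot2 (bval (fpoly K) (z K) x) (conormal (loc K a) (loc K b)) * g K x) +
  eint (loc L b) (loc L a) (fun x =>
    dot2 (bval (fpoly L) (z L) x) (conormal (loc L b) (loc L a)) * g L x) = 0.
Proof.
move=> zS abK baL gK gL gKL.
have [[aK bK] [bL aL]] := (mem_cyc abK, mem_cyc baL).
have [zK _ _ _] := zS.
rewrite /eint !norm2_locB// (norm3B (pos a)) -mulrDr.
(* [eint] carries the edge length as a factor, so length 0 is trivial; otherwise that factor can be
   cancelled from the mean condition on the jump. *)
have [->|ab0] := eqVneq (norm3 (pos b - pos a)) 0; first by rewrite mul0r.
have m01 : measurable (`[0, 1] : set (measurableTypeR R)) by exact: measurable_itv.
pose fK (s : R) := dot2 (bval (fpoly K) (z K) (seg (loc K a) (loc K b) s))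
  (conormal (loc K a) (loc K b)) * g K (seg (loc K a) (loc K b) s).
pose fL (s : R) := dot2 (bval (fpoly L) (z L) (seg (loc L b) (loc L a) s))
  (conormal (loc L b) (loc L a)) * g L (seg (loc L b) (loc L a) s).
rewrite -[X in _ * (X + _)]/(\int[mu]_(s in `[0, 1]) fK s).
rewrite -[X in _ * (_ + X)]/(\int[mu]_(s in `[0, 1]) fL s).
have iK : mu.-integrable `[0, 1] (EFin \o fK).
  apply: sqint_integrableM => //.
  exact: quadratic01_sqint (bval_quadratic _ (zK K) (mem_edges_fpoly abK)).
have iL : mu.-integrable `[0, 1] (EFin \o fL).
  apply: sqint_integrableM => //.
  exact: quadratic01_sqint (bval_quadratic _ (zK L) (mem_edges_fpoly baL)).
rewrite -(Rintegral_onem01 iL).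
suff -> : \int[mu]_(s in `[0, 1]) fL (1 - s) = - \int[mu]_(s in `[0, 1]) fK s.
  by rewrite subrr mulr0.
rewrite -mulN1r -RintegralZl//; congr fine.
have mK : measurable_fun (`[0, 1] : set (measurableTypeR R)) fK.
  by have /integrableP[/measurable_EFinP] := iK.
have mL : measurable_fun (`[0, 1] : set (measurableTypeR R)) fL.
  by have /integrableP[/measurable_EFinP] := iL.
apply: ae_eq_integral => //.
- apply/measurable_EFinP; apply: (measurable_comp m01 _ mL).
    by move=> _ [s s01 <-]; exact: onem_in01.
  by apply: measurable_funB.
- by apply/measurable_EFinP; exact: measurable_funM.
(* The normal jump vanishes at every point of the edge, so the exceptional null set comes from the
   traces of [g] alone. *)
- move: gKL; apply: filterS; first exact: (ae_filter_ringOfSetsType mu).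
  move=> s gs s01; congr EFin.
  have /eqP := normal_jump_eq0 zS abK baL ab0 s01.
  rewrite /normal_jump addrC addr_eq0 /fK /fL seg_onem => /eqP ->.
  by rewrite -/(ept L a b s) -(gs s01) mulN1r mulNr.
Qed.

(* Summing over pairs of faces makes the exchange of the two sides of each edge
   a change of summation index. *)
Lemma sum_opposite_edges (F : face G -> vertex G * vertex G -> R) :
  (forall K L a b, (a, b) \in fedges K -> (b, a) \in fedges L ->
     F K (a, b) + F L (b, a) = 0) ->
  \sum_K \sum_(e <- fedges K) F K e = 0.
Proof.
move=> Fopp.
pose sw (e : vertex G * vertex G) := (e.2, e.1).
have swK : involutive sw by case.
(* [T] retains [F K e] exactly when [K] and [L] lie on the two sides of [e]. *)
pose T e K L := if (e \in fedges K) && (sw e \in fedges L) then F K e else 0.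
have SE : \sum_K \sum_(e <- fedges K) F K e = \sum_e \sum_K \sum_L T e K L.
  rewrite exchange_big; apply: eq_bigr => K _ /=.
  rewrite big_uniq ?fedges_uniq// big_mkcond; apply: eq_bigr => -[a b] _ /=.
  rewrite /T; case: ifPn => abK /=; last by rewrite big1.
  (* Exactly one face traverses the edge backwards, so the sum over [L] has a single nonzero
     term. *)
  have [L0 baL0] := edge_opposite abK.
  rewrite (bigD1 L0)//= baL0 big1 ?addr0// => L LL0.
  by case: ifPn => // baL; rewrite (edge_unique baL baL0) eqxx in LL0.
have SE' : \sum_e \sum_K \sum_L T e K L = \sum_e \sum_K \sum_L T (sw e) L K.
  rewrite (reindex_inj (inv_inj swK)); apply: eq_bigr => e _.
  by rewrite exchange_big.
(* Twice the sum is 0, since [T e K L] and [T (sw e) L K] are the two opposite contributions of one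
   edge. *)
have S2 : \sum_e \sum_K \sum_L T e K L + \sum_e \sum_K \sum_L T e K L = 0.
  rewrite {2}SE' -big_split big1// => -[a b] _.
  rewrite -big_split big1// => K _; rewrite -big_split big1// => L _.
  rewrite /T /sw/=; case: (boolP ((a, b) \in _)) => abK; last by rewrite andbF addr0.
  by rewrite andbT /=; case: ifPn => baL; [exact: Fopp|exact: addr0].
by rewrite SE; lra.
Qed.

Lemma sum_recon_grad_eq0 z r theta : Sigma_h z -> is_Rhc z r -> H1_surf theta ->
  \sum_K ipv (freg K) (r K) (gradh theta K) = 0.
Proof.
move=> zS zr [thetaH [g [gtr gKL]]].
have [zK _ _ _] := zS.
(* The right-hand 0 is rewritten as the total edge flux, leaving one Green formula per face to
   verify. *)
rewrite -[RHS](@sum_opposite_edges (fun K e =>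
  eint (loc K e.1) (loc K e.2) (fun x => dot2 (bval (fpoly K) (z K) x)
    (conormal (loc K e.1) (loc K e.2)) * g K x))).
  apply: eq_bigr => K _.
  have [[rdiv _ r0 rn] _] := zr K.
  have [_ _ _ [cK _ _] _] := face_polygon K.
  rewrite (normal_trace_green cK r0 rdiv.1 rn _ (thetaH K) (gtr K)).
    by rewrite edges_fpoly big_map.
  by move=> e eK; exact: quadratic01_sqint (bval_quadratic _ (zK K) eK).
move=> K L a b abK baL; apply: edge_flux_opposite => //.
- exact: (gtr K).1 _ (mem_edges_fpoly abK).
- exact: (gtr L).1 _ (mem_edges_fpoly baL).
- exact: gKL.
Qed.

End edge_cancellation.

(** * Additivity of the load under a gradient perturbation *)

Section load.
Context {R : realType} (G : polysurf R).
Let T2 := (measurableTypeR R * measurableTypeR R)%type.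

Lemma L2_dot3 (D : set (R * R)) (f : R * R -> 'rV[R]_3) t :
  measurable (D : set T2) -> (forall i, L2 D (fun y => f y 0 i)) ->
  L2 D (fun y => dot3 (f y) t).
Proof.
move=> mD f2; have h := sqintD mD (sqintD mD (sqintMr mD (t 0 0) (f2 0))
  (sqintMr mD (t 0 1) (f2 1))) (sqintMr mD (t 0 2%:R) (f2 2%:R)).
rewrite (_ : (fun y => _) = fun y =>
    f y 0 0 * t 0 0 + f y 0 1 * t 0 1 + f y 0 2%:R * t 0 2%:R); first exact: h.
by apply/funext => y; rewrite dot3E.
Qed.

Lemma integrable_dot2 (D : set (R * R)) (v w : R * R -> R * R) :
  measurable (D : set T2) -> L2v D v -> L2v D w ->
  (leb2 R).-integrable D (EFin \o (fun y => dot2 (v y) (w y))).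
Proof.
move=> mD [v1 v2] [w1 w2].
by have := integrableD mD (sqint_integrableM mD v1 w1) (sqint_integrableM mD v2 w2).
Qed.

(** [push] preserves inner products, so the added part of the load is the planar pairing of the
    gradient with [r]. Square integrability lets the integral split. *)
Lemma loadZ_gradh (f : vfield3 G) (theta : surf_fun G) (r : surf_field G) :
  (forall K, L2v (freg K) (r K)) -> L2_tangential f ->
  (forall K, H1 (freg K) (theta K)) ->
  loadZ (fun K y => f K y + push_field (gradh theta) K y) r =
  loadZ f r + \sum_K ipv (freg K) (r K) (gradh theta K).
Proof.
move=> r2 f2 theta1; rewrite /loadZ /ip_surf -big_split; apply: eq_bigr => K _ /=.
have [_ _ _ [cK _ _] _] := face_polygon K.
have mK : measurable (freg K : set T2) := compact_measurable2 cK.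
have [_ [w wtheta]] := theta1 K.
have [grad2 _] : is_wgrad (freg K) (theta K) (wgrad (freg K) (theta K)).
  exact: (xgetI _ wtheta).
(* Pairing with a pushed planar field sees [f] only through its two chart components. *)
pose F (y : R * R) := (dot3 (f K y) (tau1 K), dot3 (f K y) (tau2 K)).
have fE (y : R * R) : dot3 (f K y) (push_field r K y) = dot2 (F y) (r K y).
  by rewrite /push_field /push dot3Dr !dot3Zr /dot2 /=; ring.
rewrite /ipv -RintegralD//.
- apply: eq_Rintegral => y _; rewrite dot3Dl dot3_push; congr (_ + _).
  by rewrite /dot2 mulrC (mulrC (r K y).2).
- under [X in EFin \o X]eq_fun do rewrite fE.
  by apply: integrable_dot2 => //; split; apply: L2_dot3 => //; exact: (f2 K).1.
- exact: integrable_dot2.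
Qed.

End load.

Theorem lemma4p3 (R : realType) (gamma : set 'rV[R]_3) (d : 'rV[R]_3 -> R)
    (delta rho C h0 : R)
    (hgamma : C4_closed_surface gamma) (htube : tubular_nbhd gamma delta d)
    (hrho : 0 < rho) (hC : 0 < C) (hh0 : small_h0 gamma delta d rho C h0)
    (G : polysurf R) (hG : mesh_assumption gamma delta d rho C G)
    (hh : 0 < meshsize G <= h0)
    (z r : surf_field G) (hz : Z_h z) (hr : is_Rhc z r) :
  [/\ Hdiv_surf r, is_surf_div r (fun _ _ => 0) &
    forall f : vfield3 G, L2_tangential f ->
    forall theta : surf_fun G, H1_surf theta ->
      loadZ (fun K y => f K y + push_field (gradh theta) K y) r = loadZ f r].
Proof.
have r2 K : L2v (freg K) (r K) by have [[[]]] := hr K.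
(* This orthogonality to surface gradients serves twice: as the weak form of zero divergence and as
   the invariance of the load. *)
have rgrad theta : H1_surf theta ->
    \sum_K ipv (freg K) (r K) (gradh theta K) = 0.
  exact: sum_recon_grad_eq0 hz.1 hr.
have rdiv : is_surf_div r (fun _ _ => 0).
  split=> [K|theta theta1].
    split; first exact: measurable_cst.
    by rewrite integral0_eq// => x _; rewrite expr0n.
  rewrite rgrad// big1 ?oppr0// => K _.
  rewrite /ip (@eq_Rintegral _ _ _ _ _ (fun=> 0)); last by move=> x _; rewrite mul0r.
  by rewrite /Rintegral integral0.
split=> //; first by split => //; exists (fun _ _ => 0).
by move=> f f2 theta theta1; rewrite loadZ_gradh// ?rgrad ?addr0//; case: theta1.
Qed.
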